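(* Let $X$ be a set and let $\Omega$ be a semigroup. The free tridendriform family algebra $\bigl(\mathrm{DT}(X,\Omega),(\prec_\omega,\succ_\omega)_{\omega\in\Omega},\cdot\bigr)$ on $X$ is a tridendriform family subalgebra of the free Rota-Baxter family algebra $\bigl(\mathbf{k}\mathcal{T}(X,\Omega),\diamond,(B^+_\omega)_{\omega\in\Omega}\bigr)$ of weight $1$, the latter being equipped with its induced tridendriform family structure $T\prec'_\omega U=T\diamond B^+_\omega(U)$, $T\succ'_\omega U=B^+_\omega(T)\diamond U$, $T\cdot'U=T\diamond U$. That is, the submodule $\mathrm{DT}(X,\Omega)\subseteq\mathbf{k}\mathcal{T}(X,\Omega)$ is closed under $\cdot'$ and all $\prec'_\omega,\succ'_\omega$, and $T\prec_\omega U=T\prec'_\omega U$, $T\succ_\omega U=T\succ'_\omega U$, $T\cdot U=T\cdot'U$ for all $T,U\in\mathrm{DT}(X,\Omega)$ and $\omega\in\Omega$.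
   Context: $\mathbf{k}$ is a unitary commutative ring; algebras are unitary associative $\mathbf{k}$-algebras. **Rota-Baxter family algebras.** A Rota-Baxter family of weight $\lambda\in\mathbf{k}$ on an algebra $R$ is a collection of linear operators $(P_\omega)_{\omega\in\Omega}$ on $R$ with $P_\alpha(a)P_\beta(b)=P_{\alpha\beta}\bigl(P_\alpha(a)b+aP_\beta(b)+\lambda ab\bigr)$ for all $a,b\in R$, $\alpha,\beta\in\Omega$. **Trees.** Let $\Omega^1$ be $\Omega$ with an identity $1$ adjoined if it has none. $\mathcal{T}(X,\Omega)$ is the set of typed angularly decorated planar rooted trees: planar rooted trees with at least one vertex, where the root and the leaves are edges, each angle (pair of adjacent incoming edges at a vertex) is decorated by an element of $X$, each internal edge (neither leaf nor root) is decorated by an element of $\Omega$, leaves are decorated by $1$, and the root edge is undecorated. The symbol $|$ denotes the tree with no vertex ($|\notin\mathcal{T}(X,\Omega)$). Every $T\in\mathcal{T}(X,\Omega)$ is written uniquely as $$T=\langle(\alpha_1,T_1),x_1,(\alpha_2,T_2),x_2,\dots,x_n,(\alpha_{n+1},T_{n+1})\rangle,\quad n\ge0,$$ where the lowest vertex has branches $T_1,\dots,T_{n+1}\in\mathcal{T}(X,\Omega)\sqcup\{|\}$ from left to right, $x_i\in X$ decorates the angle between the $i$-th and $(i+1)$-st incoming edges, and $\alpha_i$ is the type of the edge carrying $T_i$: $\alpha_i\in\Omega$ if $T_i\ne|$, and $\alpha_i=1$ if $T_i=|$. The bracket is extended multilinearly when $T_i\neq |$ is replaced by a linear combination of trees.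 $\mathbf{k}\mathcal{T}(X,\Omega)$ is the free $\mathbf{k}$-module on $\mathcal{T}(X,\Omega)$. For $\omega\in\Omega$, $B^+_\omega$ is the linear operator on it with $B^+_\omega(T)=\langle(\omega,T)\rangle$ for $T\in\mathcal{T}(X,\Omega)$. **Product (weight $\lambda$, used here with $\lambda=1$).** The depth is $\operatorname{dep}(|)=0$ and $\operatorname{dep}(T)=1+\max_i\operatorname{dep}(T_i)$. The bilinear product $\diamond$ is defined on trees by induction on $\operatorname{dep}(T)+\operatorname{dep}(T')$: for $T=\langle(\alpha_1,T_1),x_1,\dots,x_m,(\alpha_{m+1},T_{m+1})\rangle$ and $T'=\langle(\beta_1,T'_1),y_1,\dots,y_n,(\beta_{n+1},T'_{n+1})\rangle$, $$T\diamond T'=\langle(\alpha_1,T_1),x_1,\dots,x_m,(\gamma,V),y_1,(\beta_2,T'_2),\dots,y_n,(\beta_{n+1},T'_{n+1})\rangle,$$ where $(\gamma,V)=(1,|)$ if $T_{m+1}=|=T'_1$; $(\gamma,V)=(\alpha_{m+1},T_{m+1})$ if $T_{m+1}\ne|=T'_1$; $(\gamma,V)=(\beta_1,T'_1)$ if $T_{m+1}=|\ne T'_1$; and, if $T_{m+1}\neq|\neq T'_1$, $\gamma=\alpha_{m+1}\beta_1$ and $V=B^+_{\alpha_{m+1}}(T_{m+1})\diamond T'_1+T_{m+1}\diamond B^+_{\beta_1}(T'_1)+\lambda\,T_{m+1}\diamond T'_1$. The unit is $\langle(1,|)\rangle$. The triple $(\mathbf{k}\mathcal{T}(X,\Omega),\diamond,(B^+_\omega)_\omega)$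 is the free Rota-Baxter family algebra of weight $\lambda$ on $X$. **Tridendriform family algebras.** A tridendriform family algebra is a $\mathbf{k}$-module with binary (bilinear) operations $(\prec_\omega,\succ_\omega)_{\omega\in\Omega}$ and $\cdot$ such that for all elements $x,y,z$ and $\alpha,\beta\in\Omega$: $(x\prec_\alpha y)\prec_\beta z=x\prec_{\alpha\beta}(y\prec_\beta z+y\succ_\alpha z+y\cdot z)$; $(x\succ_\alpha y)\prec_\beta z=x\succ_\alpha(y\prec_\beta z)$; $(x\prec_\beta y+x\succ_\alpha y+x\cdot y)\succ_{\alpha\beta}z=x\succ_\alpha(y\succ_\beta z)$; $(x\succ_\alpha y)\cdot z=x\succ_\alpha(y\cdot z)$; $(x\prec_\alpha y)\cdot z=x\cdot(y\succ_\alpha z)$; $(x\cdot y)\prec_\alpha z=x\cdot(y\prec_\alpha z)$; $(x\cdot y)\cdot z=x\cdot(y\cdot z)$. A Rota-Baxter family algebra of weight $1$ is a tridendriform family algebra via $a\prec_\omega b=aP_\omega(b)$, $a\succ_\omega b=P_\omega(a)b$, $a\cdot b=ab$. **$\mathrm{DT}(X,\Omega)$.** It is the submodule of $\mathbf{k}\mathcal{T}(X,\Omega)$ spanned by Schröder trees (every vertex has at least two incoming edges). The bilinear operations are defined recursively on $\operatorname{dep}(T)+\operatorname{dep}(U)$, with the conventions, for $\omega\in\Omega^1$ and a Schröder tree $T\ne|$: $|\succ_\omega T=T\prec_\omega|=T$, $|\prec_\omega T=T\succ_\omega|=0$, $|\cdot T=T\cdot|=0$, and $|\prec_1|+|\succ_1|+|\cdot|=|$.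 For $T=\langle(\alpha_0,T^{(0)}),x_1,\dots,x_m,(\alpha_m,T^{(m)})\rangle$, $U=\langle(\beta_0,U^{(0)}),y_1,\dots,y_n,(\beta_n,U^{(n)})\rangle$ with $m,n\ge1$, and $\omega\in\Omega$: $$T\prec_\omega U=\langle(\alpha_0,T^{(0)}),x_1,\dots,x_m,(\alpha_m\omega,\;T^{(m)}\succ_{\alpha_m}U+T^{(m)}\prec_\omega U+T^{(m)}\cdot U)\rangle,$$ $$T\succ_\omega U=\langle(\omega\beta_0,\;T\succ_\omega U^{(0)}+T\prec_{\beta_0}U^{(0)}+T\cdot U^{(0)}),y_1,(\beta_1,U^{(1)}),\dots,y_n,(\beta_n,U^{(n)})\rangle,$$ $$T\cdot U=\langle(\alpha_0,T^{(0)}),x_1,\dots,x_m,(\alpha_m\beta_0,W),y_1,(\beta_1,U^{(1)}),\dots,y_n,(\beta_n,U^{(n)})\rangle,$$ with $W=T^{(m)}\succ_{\alpha_m}U^{(0)}+T^{(m)}\prec_{\beta_0}U^{(0)}+T^{(m)}\cdot U^{(0)}$. With $x\mapsto\langle(1,|),x,(1,|)\rangle$ this is known to be the free tridendriform family algebra on $X$. *)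

(* Defs.v *)
(* Classical axioms are only used to make the type of trees, over an arbitrary
   type of decorations, a choiceType. *)
From HB Require Import structures.
From mathcomp Require Import all_boot all_order all_algebra.
From mathcomp Require Import finmap.
From mathcomp Require Import zify.
From mathcomp Require Import boolp.
From mathcomp.multinomials Require Import monalg.

Set Implicit Arguments.
Unset Strict Implicit.
Unset Printing Implicit Defensive.

Import GRing.Theory.
Local Open Scope ring_scope.

(* The free k-module on a set of generators.  [{malg k[T]}] only has a module
   structure over rings with 1 != 0; the alias carries the same one over an
   arbitrary unitary ring. *)
Section FreeModule.
Variables (k : pzRingType) (T : choiceType).

Definition freemod : Type := {malg k[T]}.

HB.instance Definition _ := GRing.Zmodule.on freemod.

Definition fm_coef (x : freemod) (t : T) : k := mcoeff t (x : {malg k[T]}).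
Definition fm_supp (x : freemod) : {fset T} := msupp (x : {malg k[T]}).
Definition fm_gen (t : T) : freemod := mkmalgU t (1 : k).
Definition fm_scale (c : k) (x : freemod) : freemod :=
  [malg t in fm_supp x => c * fm_coef x t].

Lemma fm_scaleE c x t : fm_coef (fm_scale c x) t = c * fm_coef x t.
Proof.
rewrite /fm_coef /fm_scale mcoeffE.
by case: ifPn => // /mcoeff_outdom tx; rewrite /fm_coef tx mulr0.
Qed.

Lemma fm_coefD x y t : fm_coef (x + y) t = fm_coef x t + fm_coef y t.
Proof. exact: mcoeffD. Qed.

Lemma fm_coefP (x y : freemod) : (forall t, fm_coef x t = fm_coef y t) <-> x = y.
Proof. exact: malgP. Qed.

Fact fm_scaleA a b x : fm_scale a (fm_scale b x) = fm_scale (a * b) x.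
Proof. by apply/fm_coefP => t; rewrite !fm_scaleE mulrA. Qed.

Fact fm_scale1 : left_id 1 fm_scale.
Proof. by move=> x; apply/fm_coefP => t; rewrite fm_scaleE mul1r. Qed.

Fact fm_scaleDr : right_distributive fm_scale +%R.
Proof.
by move=> c x y; apply/fm_coefP => t; rewrite fm_coefD !fm_scaleE fm_coefD mulrDr.
Qed.

Fact fm_scaleDl x : {morph fm_scale^~ x : a b / a + b}.
Proof.
by move=> a b; apply/fm_coefP => t; rewrite fm_coefD !fm_scaleE mulrDl.
Qed.

HB.instance Definition _ := GRing.Zmodule_isLmodule.Build k freemod
  fm_scaleA fm_scale1 fm_scaleDr fm_scaleDl.

End FreeModule.

Section Extension.
Variables (k : pzRingType) (T : choiceType) (V : lmodType k).

Definition lin_ext (f : T -> V) (x : freemod k T) : V :=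
  \sum_(t <- fm_supp x) fm_coef x t *: f t.

Definition bilin_ext (f : T -> T -> V) (x y : freemod k T) : V :=
  lin_ext (fun t => lin_ext (f t) y) x.

Definition span (P : pred T) (x : freemod k T) : Prop :=
  exists2 s : seq (k * T), all P (unzip2 s) &
    x = \sum_(p <- s) p.1 *: fm_gen k p.2.

End Extension.

Section Trees.
Variables (X : Type) (Omega : semigroupType).

(* [Node b1 [:: (x1, b2); ..; (xn, b_{n+1})]] is the tree
   <(a1,T1), x1, (a2,T2), .., xn, (a_{n+1},T_{n+1})>, where each branch
   (ai, Ti) is either the leaf (1, |) or [Edge ai Ti]. *)
Inductive tree : Type := Node of branch & seq (X * branch)
with branch : Type := Leaf | Edge of Omega & tree.

HB.instance Definition _ := gen_eqMixin tree.
HB.instance Definition _ := gen_choiceMixin tree.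

Fixpoint depth (T : tree) : nat :=
  let: Node b s := T in
  (foldr (fun p d => let: (_, c) := p in maxn (branch_depth c) d)
     (branch_depth b) s).+1
with branch_depth (b : branch) : nat :=
  if b is Edge _ T then depth T else 0.

Fixpoint schroeder (T : tree) : bool :=
  let: Node b s := T in
  [&& (0 < size s)%N, branch_schroeder b &
      all (fun p => let: (_, c) := p in branch_schroeder c) s]
with branch_schroeder (b : branch) : bool :=
  if b is Edge _ T then schroeder T else true.

Definition Bplus_tree (w : Omega) (T : tree) : tree := Node (Edge w T) [::].

Definition first_branch (T : tree) : branch := let: Node b _ := T in b.
Definition last_branch (T : tree) : branch :=
  let: Node b s := T in last b (unzip2 s).

Fixpoint replace_last (b : branch) (s : seq (X * branch)) (c : branch) : tree :=
  if s is (x, b') :: s' then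
    let: Node c0 r := replace_last b' s' c in Node b ((x, c0) :: r)
  else Node c [::].

Definition set_last (T : tree) (c : branch) : tree :=
  let: Node b s := T in replace_last b s c.
Definition set_first (U : tree) (c : branch) : tree :=
  let: Node _ s := U in Node c s.

(* For T with last branch b_m and U with first branch c_0,
   <.., x_m, b_m> and <c_0, y_1, ..> give <.., x_m, c, y_1, ..>. *)
Definition glue (T : tree) (c : branch) (U : tree) : tree :=
  let: Node b s := set_last T c in let: Node _ r := U in Node b (s ++ r).

(* The adjoined identity is [None].  The type of a leaf edge is forced, so it
   is not stored in the tree; when Omega already has an identity e, [None]
   stands for the occurrences of e as the type of a leaf, and the products
   below agree with those of Omega. *)
Definition unital : Type := option Omega.

Definition umul (a b : unital) : unital :=
  match a, b with
  | Some a, Some b => Some (a * b)%g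
  | None, _ => b
  | _, None => a
  end.

Definition branch_type (b : branch) : unital :=
  if b is Edge a _ then Some a else None.

End Trees.

Arguments Leaf {X Omega}.

Section FreeAlgebras.
Variables (k : comPzRingType) (X : Type) (Omega : semigroupType).
Local Notation tree := (tree X Omega).
Local Notation branch := (branch X Omega).
Local Notation kT := (freemod k tree).
Local Notation gen := (@fm_gen k tree).

(* [bracket C g V] is the multilinear bracket C[(g, V)], where the context C
   is a tree with a missing branch.  The type [None] only occurs when
   V = |, that is, when the branch is the leaf (1, |). *)
Definition bracket (C : branch -> tree) (g : unital Omega) (V : kT) : kT :=
  if g is Some a then lin_ext (fun t => gen (C (Edge a t))) V
  else gen (C Leaf).

Definition Bplus (w : Omega) : kT -> kT :=
  lin_ext (fun T => gen (Bplus_tree w T)).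

(* The recursion is on [n], an upper bound of depth T + depth U:
   see [diamond_treeE]. *)
Fixpoint diamond_rec (lam : k) (n : nat) (T U : tree) : kT :=
  if n is m.+1 then
    match last_branch T, first_branch U with
    | Leaf, Leaf => gen (glue T Leaf U)
    | Edge a t, Leaf => gen (glue T (Edge a t) U)
    | Leaf, Edge b u => gen (glue T (Edge b u) U)
    | Edge a t, Edge b u =>
        bracket (fun c => glue T c U) (Some (a * b)%g)
          (diamond_rec lam m (Bplus_tree a t) u
           + diamond_rec lam m t (Bplus_tree b u)
           + lam *: diamond_rec lam m t u)
    end
  else 0.

Definition diamond_tree (lam : k) (T U : tree) : kT :=
  diamond_rec lam (depth T + depth U) T U.

Definition diamond (lam : k) : kT -> kT -> kT := bilin_ext (diamond_tree lam).

(* Extensions of operations on trees to T, U in trees + {|}.  The operands are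
   branches (a, T) and (b, U), which carry the edge types needed in
   succ_a(T, U) + prec_b(T, U) + dot(T, U).  The combination of | with | is never used: it comes
   with the type 1 * 1 = [None], for which [bracket] puts a leaf. *)
Section Conventions.
Variables (prec succ : Omega -> tree -> tree -> kT) (dot : tree -> tree -> kT).

Definition prec_ext (b c : branch) : kT :=
  match b, c with
  | Edge _ T, Edge w U => prec w T U
  | Edge _ T, Leaf => gen T
  | Leaf, _ => 0
  end.

Definition succ_ext (b c : branch) : kT :=
  match b, c with
  | Edge w T, Edge _ U => succ w T U
  | Leaf, Edge _ U => gen U
  | _, Leaf => 0
  end.

Definition dot_ext (b c : branch) : kT :=
  if b is Edge _ T then if c is Edge _ U then dot T U else 0 else 0.

Definition merge (b c : branch) : kT :=
  succ_ext b c + prec_ext b c + dot_ext b c.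

End Conventions.

(* As for [diamond_rec], [n] bounds depth T + depth U.  The formulas make sense
   for all trees, but are only meant for Schroeder trees, whose branches are
   again Schroeder trees or leaves. *)
Fixpoint prec_rec (n : nat) (w : Omega) (T U : tree) : kT :=
  if n is m.+1 then
    bracket (set_last T) (umul (branch_type (last_branch T)) (Some w))
      (merge (prec_rec m) (succ_rec m) (dot_rec m) (last_branch T) (Edge w U))
  else 0
with succ_rec (n : nat) (w : Omega) (T U : tree) : kT :=
  if n is m.+1 then
    bracket (set_first U) (umul (Some w) (branch_type (first_branch U)))
      (merge (prec_rec m) (succ_rec m) (dot_rec m) (Edge w T) (first_branch U))
  else 0
with dot_rec (n : nat) (T U : tree) : kT :=
  if n is m.+1 then
    bracket (fun c => glue T c U)
      (umul (branch_type (last_branch T)) (branch_type (first_branch U)))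
      (merge (prec_rec m) (succ_rec m) (dot_rec m)
         (last_branch T) (first_branch U))
  else 0.

Definition prec_tree w T U := prec_rec (depth T + depth U) w T U.
Definition succ_tree w T U := succ_rec (depth T + depth U) w T U.
Definition dot_tree T U := dot_rec (depth T + depth U) T U.

Definition DT : kT -> Prop := span (@schroeder X Omega).

Definition DT_prec (w : Omega) : kT -> kT -> kT := bilin_ext (prec_tree w).
Definition DT_succ (w : Omega) : kT -> kT -> kT := bilin_ext (succ_tree w).
Definition DT_dot : kT -> kT -> kT := bilin_ext dot_tree.

(* The tridendriform family structure induced by a Rota-Baxter family algebra
   of weight 1, here (kT, diamond, Bplus). *)
Definition RB_prec (w : Omega) (x y : kT) : kT := diamond 1 x (Bplus w y).
Definition RB_succ (w : Omega) (x y : kT) : kT := diamond 1 (Bplus w x) y.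
Definition RB_dot (x y : kT) : kT := diamond 1 x y.

(* The remaining facts show that the bound on the recursion plays no role and
   that the operations satisfy their defining equations. *)

Lemma depth_first (T : tree) :
  (branch_depth (first_branch T) < depth T)%N.
Proof.
case: T => b s /=; rewrite ltnS.
by elim: s => //= -[x c] s IHs; rewrite leq_max IHs orbT.
Qed.

Lemma depth_last (T : tree) : (branch_depth (last_branch T) < depth T)%N.
Proof.
case: T => b s /=; rewrite ltnS; elim: s b => //= -[x c] s IHs b /=.
case: s IHs => [|q s] IHs /=; first by rewrite leq_max leqnn.
have := IHs b; rewrite /= => H; rewrite leq_max; apply/orP; right.
exact: H.
Qed.

Lemma depth_Bplus w (T : tree) : depth (Bplus_tree w T) = (depth T).+1.
Proof. by []. Qed.

Lemma diamond_rec_depth lam n (T U : tree) : (depth T + depth U <= n)%N ->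
  diamond_rec lam n T U = diamond_tree lam T U.
Proof.
suff H m p (T' U' : tree) :
    (depth T' + depth U' <= m)%N -> (depth T' + depth U' <= p)%N ->
    diamond_rec lam m T' U' = diamond_rec lam p T' U'.
  by move=> h; apply: H.
elim: m p T' U' => [|m IHm] [|p] T' U' //= h1 h2.
- by have := depth_first T'; lia.
- by have := depth_first T'; lia.
have := depth_last T'; have := depth_first U'.
case: (last_branch T') => [|a t]; case: (first_branch U') => [|b u] //=.
move=> hu ht.
by congr (lin_ext _ (_ + _ + _ *: _)); apply: IHm; rewrite ?depth_Bplus; lia.
Qed.

Lemma diamond_treeE lam (T U : tree) : diamond_tree lam T U =
  match last_branch T, first_branch U with
  | Leaf, Leaf => gen (glue T Leaf U)
  | Edge a t, Leaf => gen (glue T (Edge a t) U)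
  | Leaf, Edge b u => gen (glue T (Edge b u) U)
  | Edge a t, Edge b u =>
      bracket (fun c => glue T c U) (Some (a * b)%g)
        (diamond_tree lam (Bplus_tree a t) u
         + diamond_tree lam t (Bplus_tree b u)
         + lam *: diamond_tree lam t u)
  end.
Proof.
rewrite -(@diamond_rec_depth _ (depth T + depth U).+1) //=.
have := depth_last T; have := depth_first U.
case: (last_branch T) => [|a t]; case: (first_branch U) => [|b u] //= hu ht.
by rewrite !diamond_rec_depth // ?depth_Bplus; lia.
Qed.

Lemma rec_depth n (T U : tree) : (depth T + depth U <= n)%N ->
  [/\ forall w, prec_rec n w T U = prec_tree w T U,
      forall w, succ_rec n w T U = succ_tree w T U &
      dot_rec n T U = dot_tree T U].
Proof.
suff H m p (T' U' : tree) :
    (depth T' + depth U' <= m)%N -> (depth T' + depth U' <= p)%N ->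
    [/\ forall w, prec_rec m w T' U' = prec_rec p w T' U',
        forall w, succ_rec m w T' U' = succ_rec p w T' U' &
        dot_rec m T' U' = dot_rec p T' U'].
  by move=> h; apply: H.
elim: m p T' U' => [|m IHm] [|p] T' U' //= h1 h2.
- by have := depth_first T'; lia.
- by have := depth_first T'; lia.
have hT := depth_last T'; have hU := depth_first U'.
have M (b c : branch) :
    (branch_depth b + branch_depth c < depth T' + depth U')%N ->
    merge (prec_rec m) (succ_rec m) (dot_rec m) b c
    = merge (prec_rec p) (succ_rec p) (dot_rec p) b c.
  case: b c => [|a t] [|b u] //= h.
  have [] := IHm p t u; [lia|lia|move=> e1 e2 e3].
  by rewrite /merge /= e1 e2 e3.
split=> [w|w|]; congr (bracket _ _ _); apply: M => /=; lia.
Qed.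

Definition merge_tree := merge prec_tree succ_tree dot_tree.

Lemma merge_rec n (b c : branch) : (branch_depth b + branch_depth c <= n)%N ->
  merge (prec_rec n) (succ_rec n) (dot_rec n) b c = merge_tree b c.
Proof.
case: b c => [|a t] [|b u] //= h; rewrite /merge_tree /merge /=.
by have [-> -> ->] := rec_depth h.
Qed.

Lemma prec_treeE w (T U : tree) : prec_tree w T U =
  bracket (set_last T) (umul (branch_type (last_branch T)) (Some w))
    (merge_tree (last_branch T) (Edge w U)).
Proof.
have [<- _ _] := rec_depth (leqnSn (depth T + depth U)).
by rewrite /= merge_rec //=; have := depth_last T; lia.
Qed.

Lemma succ_treeE w (T U : tree) : succ_tree w T U =
  bracket (set_first U) (umul (Some w) (branch_type (first_branch U)))
    (merge_tree (Edge w T) (first_branch U)).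
Proof.
have [_ <- _] := rec_depth (leqnSn (depth T + depth U)).
by rewrite /= merge_rec //=; have := depth_first U; lia.
Qed.

Lemma dot_treeE (T U : tree) : dot_tree T U =
  bracket (fun c => glue T c U)
    (umul (branch_type (last_branch T)) (branch_type (first_branch U)))
    (merge_tree (last_branch T) (first_branch U)).
Proof.
have [_ _ <-] := rec_depth (leqnSn (depth T + depth U)).
by rewrite /= merge_rec //=; have := depth_last T; have := depth_first U; lia.
Qed.

End FreeAlgebras.

(* Main.v *)
Require Import Defs.
From HB Require Import structures.
From mathcomp Require Import all_boot all_order all_algebra.
From mathcomp Require Import finmap zify.
From mathcomp.multinomials Require Import monalg.

(** Both families of operations are bilinear extensions of operations on trees,
so everything happens on trees.  There the comparison

  [T prec_w U = T <> B_w(U)],  [T succ_w U = B_w(T) <> U],  [T . U = T <> U]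

holds because both sides follow the same recursion: [T <> U] only alters the
branch where the last branch [(a, t)] of [T] meets the first branch [(b, u)]
of [U], and at weight 1 the new branch has type [ab] and carries

  [B_a(t) <> u + t <> B_b(u) + t <> u],

which by induction on the depth is [t succ_a u + t prec_b u + t . u], the
combination used by the tridendriform operations.  Grafting by [B_w] turns [U]
into a single branch of type [w], so that gluing [T] to [B_w(U)] only changes
the last branch of [T], as [prec_w] does, and symmetrically for [succ_w].  The
cases with leaves are exactly what the conventions on [|] encode
([tridendriform_diamond_tree]).

For closure, the tridendriform recursion is the convenient one: unlike [<>], it
never passes through the trees [B_w(T)], which are not Schroeder.  Replacing a
branch of a Schroeder tree by a Schroeder branch, or gluing two Schroeder
trees, gives a Schroeder tree, so that the operations on trees stay in the span
([span_tridendriform_tree]). *)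

Set Implicit Arguments.
Unset Strict Implicit.
Unset Printing Implicit Defensive.

Import GRing.Theory.
Local Open Scope ring_scope.

(* The submodule spanned by generators, not the span of a sequence of vectors. *)
Local Notation span := Defs.span.

(** * Linear extension and spans in free modules *)

Section LinearExtension.
Variables (k : pzRingType) (T : choiceType) (V : lmodType k).
Implicit Types (f : T -> V) (x y : freemod k T).

(** Enlarging the support makes the sums for two vectors comparable termwise. *)
Lemma lin_ext_supp (A : {fset T}) f x : (fm_supp x `<=` A)%fset ->
  lin_ext f x = \sum_(t <- A) fm_coef x t *: f t.
Proof.
move=> xA; apply: big_fset_incl => // t _ /mcoeff_outdom.
by rewrite /fm_coef => ->; rewrite scale0r.
Qed.

Fact lin_ext_is_linear f : linear (lin_ext f).
Proof.
move=> c x y.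
pose A := (fm_supp x `|` fm_supp y `|` fm_supp (c *: x + y)%R)%fset.
rewrite !(@lin_ext_supp A) ?fsubsetUr //; first last.
- by rewrite /A -fsetUA fsubsetUl.
- by rewrite /A -fsetUA fsetUCA fsubsetUl.
rewrite scaler_sumr -big_split /=; apply: eq_bigr => t _.
by rewrite fm_coefD fm_scaleE scalerDl scalerA.
Qed.

HB.instance Definition _ f :=
  GRing.isLinear.Build k (freemod k T) V *:%R (lin_ext f) (lin_ext_is_linear f).

Lemma lin_ext_gen f t : lin_ext f (fm_gen k t) = f t.
Proof.
rewrite (@lin_ext_supp [fset t]%fset) ?msuppU_le //.
by rewrite big_seq_fset1 /fm_coef mcoeffUU scale1r.
Qed.

Lemma eq_lin_ext f g : f =1 g -> lin_ext f =1 lin_ext g.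
Proof. by move=> fg x; apply: eq_bigr => t _; rewrite fg. Qed.

End LinearExtension.

Lemma lin_ext_comp (k : pzRingType) (S T : choiceType) (V : lmodType k)
    (f : S -> freemod k T) (g : T -> V) x :
  lin_ext g (lin_ext f x) = lin_ext (fun s => lin_ext g (f s)) x.
Proof. by rewrite linear_sum; apply: eq_bigr => s _; rewrite linearZ. Qed.

Section Span.
Variables (k : pzRingType) (T : choiceType).
Implicit Types (P : pred T) (x y : freemod k T).

Lemma span0 P : span P (0 : freemod k T).
Proof. by exists [::]; rewrite ?big_nil. Qed.

Lemma span_gen P t : P t -> span P (fm_gen k t).
Proof. by move=> Pt; exists [:: (1, t)]; rewrite /= ?Pt // big_seq1 scale1r. Qed.

Lemma spanD P x y : span P x -> span P y -> span P (x + y).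
Proof.
move=> [s Ps ->] [r Pr ->]; exists (s ++ r); last by rewrite big_cat.
by rewrite /unzip2 map_cat all_cat Ps.
Qed.

Lemma spanZ P c x : span P x -> span P (c *: x).
Proof.
move=> [s Ps ->]; exists [seq (c * p.1, p.2) | p <- s].
  by rewrite /unzip2 -map_comp.
by rewrite big_map scaler_sumr; apply: eq_bigr => p _; rewrite scalerA.
Qed.

End Span.

Lemma span_lin_ext (k : pzRingType) (S T : choiceType) (P : pred S) (Q : pred T)
    (f : S -> freemod k T) x :
  (forall s, P s -> span Q (f s)) -> span P x -> span Q (lin_ext f x).
Proof.
move=> fPQ [r Pr ->]; rewrite linear_sum.
elim: r Pr => [|[c s] r IHr] /=; first by rewrite big_nil => _; apply: span0.
case/andP=> Ps Pr; rewrite big_cons; apply: spanD; last exact: IHr.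
by rewrite linearZ /= lin_ext_gen; apply/spanZ/fPQ.
Qed.

Lemma span_bilin_ext (k : pzRingType) (T : choiceType) (P : pred T)
    (f : T -> T -> freemod k T) x y :
  (forall t u, P t -> P u -> span P (f t u)) ->
  span P x -> span P y -> span P (bilin_ext f x y).
Proof.
move=> fP Px Py; apply: span_lin_ext Px => t Pt.
by apply: span_lin_ext Py => u; apply: fP.
Qed.

(** * Gluing trees *)

Section Gluing.
Variables (X : Type) (Omega : semigroupType).
Implicit Types (T U : tree X Omega) (b c : branch X Omega).

Lemma glue_Bplusr T c w U : glue T c (Bplus_tree w U) = set_last T c.
Proof. by rewrite /glue /=; case: (set_last T c) => b s; rewrite cats0. Qed.

Lemma glue_Bplusl w T c U : glue (Bplus_tree w T) c U = set_first U c.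
Proof. by case: U. Qed.

Lemma schroeder_Node b (s : seq (X * branch X Omega)) :
  schroeder (Node b s) =
  (0 < size s)%N && all (@branch_schroeder _ _) (b :: unzip2 s).
Proof. by rewrite /= all_map; congr [&& _, _ & _]; apply: eq_all => -[]. Qed.

Lemma schroeder_first T : schroeder T -> branch_schroeder (first_branch T).
Proof. by case: T => b s /and3P[]. Qed.

Lemma schroeder_last T : schroeder T -> branch_schroeder (last_branch T).
Proof.
case: T => b s; rewrite schroeder_Node /= => /and3P[_ bS sS].
by elim: s b bS sS => //= -[x b'] s IHs b _ /= /andP[]; apply: IHs.
Qed.

Lemma schroeder_set_last T c :
  schroeder T -> branch_schroeder c -> schroeder (set_last T c).
Proof.
case: T => b s; rewrite schroeder_Node /= => /andP[s_gt0 bs] cS.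
(* A tail of [s] may be empty, so the induction keeps the number of branches. *)
suff: let: Node b' s' := replace_last b s c in
      size s' = size s /\ all (@branch_schroeder _ _) (b' :: unzip2 s').
  by case: replace_last => b' s' [s's]; rewrite schroeder_Node s's s_gt0.
elim: s b bs {s_gt0} => [|[x b'] s IHs] b /=; first by rewrite cS.
case/andP=> bS /IHs; case: replace_last => b'' s' /= [-> ->].
by rewrite bS.
Qed.

Lemma schroeder_set_first U c :
  schroeder U -> branch_schroeder c -> schroeder (set_first U c).
Proof. by case: U => b s /= /and3P[-> _ ->] ->. Qed.

Lemma schroeder_glue T c U :
  schroeder T -> branch_schroeder c -> schroeder U -> schroeder (glue T c U).
Proof.
move=> TS cS; have := schroeder_set_last TS cS; rewrite /glue.
case: (set_last T c) U => b s [b' r]; rewrite !schroeder_Node /=.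
case/and3P=> s_gt0 bS sS /and3P[_ _ rS].
by rewrite size_cat ltn_addr // bS /unzip2 map_cat all_cat sS.
Qed.

End Gluing.

(** * Comparison of the operations on trees *)

Section Comparison.
Variables (k : comPzRingType) (X : Type) (Omega : semigroupType).
Local Notation tree := (tree X Omega).
Local Notation branch := (branch X Omega).
Local Notation kT := (freemod k tree).
Local Notation sch := (@schroeder X Omega).
Implicit Types (T U : tree) (b c : branch).

Lemma eq_bracket (C D : branch -> tree) g :
  C =1 D -> bracket (k := k) C g =1 bracket D g.
Proof.
move=> CD V; case: g => [a|] /=; last by rewrite CD.
by apply: eq_lin_ext => t; rewrite CD.
Qed.

(** All three comparisons are instances of this form of the product, the one
in which the conventions on [|] absorb its four cases; its hypothesis is the
comparison for the subtrees. *)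
Lemma diamond_tree_merge T U :
  (forall a t (b : Omega) u, last_branch T = Edge a t -> first_branch U = Edge b u ->
    [/\ prec_tree k b t u = diamond_tree 1 t (Bplus_tree b u),
        succ_tree k a t u = diamond_tree 1 (Bplus_tree a t) u &
        dot_tree k t u = diamond_tree 1 t u]) ->
  diamond_tree 1 T U =
  bracket (fun c => glue T c U)
    (umul (branch_type (last_branch T)) (branch_type (first_branch U)))
    (merge_tree k (last_branch T) (first_branch U)).
Proof.
rewrite diamond_treeE /merge_tree /Defs.merge.
case: (last_branch T) => [|a t]; case: (first_branch U) => [|b u] //= IH.
- by rewrite !addr0 lin_ext_gen.
- by rewrite add0r addr0 lin_ext_gen.
by have [//|//|-> -> ->] := IH a t b u; rewrite scale1r.
Qed.

(** The recursion of each operation calls all three, whence the joint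
induction.  Its measure does not count the vertex added by [Bplus_tree]: in
each case that vertex is removed before the subtrees are compared. *)
Lemma tridendriform_diamond_tree T U :
  [/\ forall w, prec_tree k w T U = diamond_tree 1 T (Bplus_tree w U),
      forall w, succ_tree k w T U = diamond_tree 1 (Bplus_tree w T) U &
      dot_tree k T U = diamond_tree 1 T U].
Proof.
have [n] := ubnP (depth T + depth U)%N; elim: n T U => // n IHn T U.
rewrite ltnS => le_n.
have IH (t u : tree) : (depth t + depth u < depth T + depth U)%N ->
    forall a b : Omega,
      [/\ prec_tree k b t u = diamond_tree 1 t (Bplus_tree b u),
        succ_tree k a t u = diamond_tree 1 (Bplus_tree a t) u &
        dot_tree k t u = diamond_tree 1 t u].
  by move=> lt_tu a b; have [|-> -> ->] := IHn t u; first lia.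
have lT := depth_last T; have fU := depth_first U.
split=> [w|w|].
- rewrite diamond_tree_merge /=.
    by rewrite prec_treeE; apply: eq_bracket => c; rewrite glue_Bplusr.
  by move=> a t b u lTE [<- <-]; apply: IH; move: lT; rewrite lTE /=; lia.
- rewrite diamond_tree_merge /=.
    by rewrite succ_treeE; apply: eq_bracket => c; rewrite glue_Bplusl.
  by move=> a t b u [<- <-] fUE; apply: IH; move: fU; rewrite fUE /=; lia.
rewrite diamond_tree_merge ?dot_treeE // => a t b u lTE fUE.
by apply: IH; move: lT fU; rewrite lTE fUE /=; lia.
Qed.

(** * Closure of Schroeder trees *)

Lemma span_bracket (C : branch -> tree) g (V : kT) :
  (forall c, branch_schroeder c -> sch (C c)) ->
  span sch V -> span sch (bracket C g V).
Proof.
move=> CS VS; case: g => [a|] /=; last by apply/span_gen/CS.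
by apply: span_lin_ext VS => t tS; apply/span_gen/CS.
Qed.

(** The recursive calls take Schroeder branches to combinations of Schroeder
trees; two leaves give 0, and then the type of the new branch is that of a
leaf, which is a Schroeder branch. *)
Lemma span_tridendriform_tree T U : sch T -> sch U ->
  [/\ forall w, span sch (prec_tree k w T U),
      forall w, span sch (succ_tree k w T U) &
      span sch (dot_tree k T U)].
Proof.
have [n] := ubnP (depth T + depth U)%N; elim: n T U => // n IHn T U.
rewrite ltnS => le_n TS US.
have M b c : (branch_depth b + branch_depth c < depth T + depth U)%N ->
    branch_schroeder b -> branch_schroeder c -> span sch (merge_tree k b c).
  rewrite /merge_tree /Defs.merge.
  case: b c => [|a t] [|b u] //= lt_bc bS cS; rewrite ?addr0 ?add0r.
  - exact: span0.
  - exact: span_gen.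
  - exact: span_gen.
  have [|//|//|Hp Hs Hd] := IHn t u; first lia.
  by apply: spanD => //; apply: spanD.
have lT := depth_last T; have fU := depth_first U.
have lTS := schroeder_last TS; have fUS := schroeder_first US.
split=> [w|w|].
- rewrite prec_treeE; apply: span_bracket => [c|].
    exact: schroeder_set_last.
  by apply: M => //=; lia.
- rewrite succ_treeE; apply: span_bracket => [c|].
    exact: schroeder_set_first.
  by apply: M => //=; lia.
rewrite dot_treeE; apply: span_bracket => [c cS|].
  exact: schroeder_glue.
by apply: M => //=; lia.
Qed.

(** * Passage to linear combinations *)

Lemma eq_bilin_ext (f g : tree -> tree -> kT) x y :
  (forall T U, f T U = g T U) -> bilin_ext f x y = bilin_ext g x y.
Proof. by move=> fg; apply: eq_lin_ext => T; apply: eq_lin_ext. Qed.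

Lemma DT_dot_RB (x y : kT) : DT_dot x y = RB_dot x y.
Proof.
by apply: eq_bilin_ext => T U; have [_ _] := tridendriform_diamond_tree T U.
Qed.

Lemma DT_prec_RB w (x y : kT) : DT_prec w x y = RB_prec w x y.
Proof.
apply: eq_lin_ext => T; rewrite lin_ext_comp; apply: eq_lin_ext => U.
by rewrite lin_ext_gen; have [->] := tridendriform_diamond_tree T U.
Qed.

Lemma DT_succ_RB w (x y : kT) : DT_succ w x y = RB_succ w x y.
Proof.
rewrite /RB_succ /diamond /bilin_ext lin_ext_comp; apply: eq_lin_ext => T.
rewrite lin_ext_gen; apply: eq_lin_ext => U.
by have [_ ->] := tridendriform_diamond_tree T U.
Qed.

End Comparison.

Theorem theorem3p10 (k : comPzRingType) (X : Type) (Omega : semigroupType) :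
  (forall x y : freemod k (tree X Omega), DT x -> DT y ->
     DT (RB_dot x y) /\
     forall w : Omega, DT (RB_prec w x y) /\ DT (RB_succ w x y)) /\
  (forall x y : freemod k (tree X Omega), DT x -> DT y ->
     DT_dot x y = RB_dot x y /\
     forall w : Omega,
       DT_prec w x y = RB_prec w x y /\ DT_succ w x y = RB_succ w x y).
Proof.
split=> x y xDT yDT; last first.
  by split=> [|w]; rewrite ?DT_dot_RB ?DT_prec_RB ?DT_succ_RB.
rewrite -DT_dot_RB; split=> [|w]; last rewrite -DT_prec_RB -DT_succ_RB; last split.
all: apply: span_bilin_ext xDT yDT => T U TS US.
all: by have [] := span_tridendriform_tree k TS US.
Qed.
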